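(* Let $M=(m_{s,t})_{s,t\in S}$ be a Coxeter matrix over a finite set $S$ and $A_S$ its associated Artin group. Then $A_S$ is parabolic-retractable if and only if $M$ is parabolic-retract-compatible.
   Context: A Coxeter matrix over a finite set $S$ is a matrix $M=(m_{s,t})_{s,t\in S}$ with entries in $\mathbb{N}\cup\{\infty\}$, $m_{s,s}=1$, and $m_{s,t}=m_{t,s}\ge 2$ for $s\neq t$. Write $\Pi(s,t,m)$ for the alternating word $sts\cdots$ of length $m$. The Artin group of $M$ is $A_S=\langle S\mid \Pi(s,t,m_{s,t})=\Pi(t,s,m_{s,t})$ for $s\neq t$, $m_{s,t}\neq\infty\rangle$. For $X\subseteq S$, $A_X$ is the subgroup generated by $X$, and $M_X$ the submatrix of $M$ indexed by $X$. A retraction of $G$ onto a subgroup $H$ is a homomorphism $\varphi:G\to H$ with $\varphi|_H=\mathrm{id}_H$. $A_S$ is parabolic-retractable if it admits a retraction onto $A_X$ for every $X\subseteq S$. $M$ is odd if all its entries are finite odd numbers. $M$ is retract-compatible if it is odd and for every triple $a,b,c\in S$ of pairwise distinct elements, up to permuting $a,b,c$, one has $m_{a,b}=m_{a,c}$ and $m_{b,c}$ divides $m_{a,b}$; a Coxeter matrix of rank $1$ is always considered retract-compatible. $M$ is parabolic-retract-compatible if there is a partition $S=T_1\sqcup\cdots\sqcup T_k$ such that (1) each $M_{T_i}$ is retract-compatible, and (2) for each $i\neq j$ there exists $n_{ij}$, either an even number or $\infty$, with $m_{a,b}=n_{ij}$ for all $(a,b)\in T_i\times T_j$. *)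

(* Defs.v *)
From mathcomp Require Import all_boot.
Set Implicit Arguments. Unset Strict Implicit. Unset Printing Implicit Defensive.

(* A Coxeter matrix over a finite set S: entries in N ∪ {∞}, encoded as
   option nat with None = ∞. *)
Definition coxeter_matrix (S : finType) (m : S -> S -> option nat) : Prop :=
  (forall s, m s s = Some 1) /\
  (forall s t, m s t = m t s) /\
  (forall s t, s != t -> m s t = None \/ exists k, m s t = Some k /\ 2 <= k).

(* Words in the generators and their inverses: (s, false) = s, (s, true) = s^-1. *)
Definition letter (S : finType) := (S * bool)%type.
Definition word (S : finType) := seq (letter S).

Definition alt (S : finType) (s t : S) (n : nat) : word S :=
  mkseq (fun i => (if odd i then t else s, false)) n.

(* The congruence on words defining the Artin group A_S: the equivalence
   relation generated by free cancellation and the Artin relations, applied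
   in arbitrary context. A_S is the set of words modulo artin_eq m. *)
Inductive artin_eq (S : finType) (m : S -> S -> option nat) : word S -> word S -> Prop :=
| ae_refl w : artin_eq m w w
| ae_sym u v : artin_eq m u v -> artin_eq m v u
| ae_trans u v w : artin_eq m u v -> artin_eq m v w -> artin_eq m u w
| ae_free u v x b : artin_eq m (u ++ (x, b) :: (x, ~~ b) :: v) (u ++ v)
| ae_rel u v s t k : s != t -> m s t = Some k ->
    artin_eq m (u ++ alt s t k ++ v) (u ++ alt t s k ++ v).

Definition word_in (S : finType) (X : {set S}) (w : word S) : bool :=
  all (fun l : letter S => l.1 \in X) w.

(* A retraction of A_S onto the parabolic subgroup A_X (the subgroup of A_S
   generated by X): a homomorphism A_S -> A_S (given on representative words,
   compatible with artin_eq and with concatenation = group product) whose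
   image lies in A_X and which is the identity on A_X. *)
Definition retraction_onto (S : finType) (m : S -> S -> option nat) (X : {set S}) : Prop :=
  exists f : word S -> word S,
    (forall u v, artin_eq m u v -> artin_eq m (f u) (f v)) /\
    (forall u v, artin_eq m (f (u ++ v)) (f u ++ f v)) /\
    (forall w, exists w', word_in X w' /\ artin_eq m (f w) w') /\
    (forall w, word_in X w -> artin_eq m (f w) w).

Definition parabolic_retractable (S : finType) (m : S -> S -> option nat) : Prop :=
  forall X : {set S}, retraction_onto m X.

Definition odd_on (S : finType) (m : S -> S -> option nat) (T : {set S}) : Prop :=
  forall s t, s \in T -> t \in T -> exists k, m s t = Some k /\ odd k.

Definition rc_triple (S : finType) (m : S -> S -> option nat) (a b c : S) : Prop :=
  m a b = m a c /\ exists p q, m b c = Some p /\ m a b = Some q /\ (p %| q).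

(* M_T retract-compatible (rank-1 case is automatic: no triples, and m s s = 1). *)
Definition retract_compatible (S : finType) (m : S -> S -> option nat) (T : {set S}) : Prop :=
  odd_on m T /\
  forall a b c, a \in T -> b \in T -> c \in T ->
    a != b -> a != c -> b != c ->
    (rc_triple m a b c \/ rc_triple m a c b \/ rc_triple m b a c \/
     rc_triple m b c a \/ rc_triple m c a b \/ rc_triple m c b a).

Definition even_or_inf (n : option nat) : Prop :=
  n = None \/ exists e, n = Some e /\ ~~ odd e.

Definition parabolic_retract_compatible (S : finType) (m : S -> S -> option nat) : Prop :=
  exists P : {set {set S}},
    partition P [set: S] /\
    (forall T, T \in P -> retract_compatible m T) /\
    (forall T1 T2, T1 \in P -> T2 \in P -> T1 != T2 ->
       exists n, even_or_inf n /\ forall a b, a \in T1 -> b \in T2 -> m a b = n).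

(* Main.v *)
Require Import Defs.
From mathcomp Require Import all_boot all_algebra all_field ring.
Set Implicit Arguments. Unset Strict Implicit. Unset Printing Implicit Defensive.

(**
If M is parabolic-retract-compatible, a retraction onto A_X is induced by a map
from the generators to X ∪ {1}: a block disjoint from X is sent to 1, and in the
other blocks m behaves like an ultrametric for divisibility, so each generator
may be sent to a nearest point of X in its block; this replaces each odd m_{s,t}
by one of its divisors.

Conversely, A_S acts on C^S by s(v) = v - F_s(v) e_s with F_s(e_s) = 1 + q_s and
F_s(e_t) F_t(e_s) = q_s (2 + z + 1/z), z a primitive m_{s,t}-th root of unity,
when m_{s,t} is odd (then q_s = q_t), and F_s(e_t) = F_t(e_s) = 0 otherwise. The
plane <e_a, e_b> is stable under A_{a,b}, so it gives representations of this
subgroup of A_S. Let g in A_{a,b} be the image of c under a retraction.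
- q = 1: if m_{a,c} and m_{b,c} are odd, then a and b are conjugate to g in
  A_{a,b}; this is absurd when m_{a,b} is not odd, as a and b are then distinct
  commuting diagonal matrices. Hence "m_{s,t} is odd" is an equivalence relation.
- q = -1 on the class of a and q = -beta elsewhere, F_a(e_b) = 1, F_b(e_a) = 0:
  on the plane a is a transvection and b a dilation of ratio beta, where
  beta = 2 if m_{a,b} is infinite, and beta has order l if m_{a,b} = 2l. If
  m_{a,c} is odd, g acts like a, and m_{b,c} = 2n forces beta^n = 1, so l | n.
- q = z a primitive p-th root of unity, p = m_{a,b} odd: the form on the plane is
  degenerate and A_{a,b} acts by affine maps. If m_{a,c} and m_{b,c} are odd, then
  p divides one of them, since otherwise g would act both like a and like b. This
  for the three pairs of a triple is retract-compatibility.
*)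

(** * Alternating composites of two maps *)

Section Alternation.

Variable Z : Type.
Implicit Types A B : Z -> Z.

Fixpoint alternate A B k z :=
  if k is k'.+1 then A (alternate B A k' z) else z.

Lemma alternate_double A B n z :
  alternate A B n.*2 z = iter n (A \o B) z.
Proof. by elim: n z => //= n IH z; rewrite IH. Qed.

Lemma alternate_doubleS A B n z :
  alternate A B n.*2.+1 z = iter n (A \o B) (A z).
Proof. by elim: n z => //= n IH z; rewrite -IH. Qed.

Lemma eq_alternate A A' B B' k :
  A =1 A' -> B =1 B' -> alternate A B k =1 alternate A' B' k.
Proof.
move=> eA eB z; elim: k A A' B B' eA eB => //= k IH A A' B B' eA eB.
by rewrite eA (IH _ B' _ A').
Qed.

End Alternation.

Lemma alternate_morph (Y Z : Type) (f : Y -> Z) (A B : Z -> Z) (A' B' : Y -> Y) k y :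
  (forall y, A (f y) = f (A' y)) -> (forall y, B (f y) = f (B' y)) ->
  alternate A B k (f y) = f (alternate A' B' k y).
Proof.
move=> eA eB; elim: k A B A' B' eA eB => //= k IH A B A' B' eA eB.
by rewrite (IH _ _ B' A').
Qed.

(** * Words modulo the Artin relations, and their actions *)

Section Words.

Variables (S : finType) (m : S -> S -> option nat).

(** The factors are words rather than letters, because a retraction may send a generator to any
    word. *)
Fixpoint altw (u v : word S) k := if k is k'.+1 then u ++ altw v u k' else [::].

Lemma altE (s t : S) k : alt s t k = altw [:: (s, false)] [:: (t, false)] k.
Proof.
elim: k s t => //= k IH s t; rewrite -IH /alt /mkseq /=; congr (_ :: _).
by rewrite (iotaDl 1 0) -map_comp; apply: eq_map => i /=; case: odd.
Qed.

Lemma word_in_altw (X : {set S}) (u v : word S) k :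
  word_in X u -> word_in X v -> word_in X (altw u v k).
Proof.
elim: k u v => //= k IH u v uX vX; rewrite /word_in all_cat.
by apply/andP; split=> //; apply: IH.
Qed.

Lemma artin_eq_ctx (x y u v : word S) :
  artin_eq m u v -> artin_eq m (x ++ u ++ y) (x ++ v ++ y).
Proof.
elim=> {u v} [w|u v _ IH|u v w _ IH1 _ IH2|u v s b|u v s t k st mk].
- exact: ae_refl.
- exact: ae_sym.
- exact: ae_trans IH1 IH2.
- by rewrite -!catA !(catA x) /=; apply: ae_free.
- by rewrite -!catA !(catA x u); apply: ae_rel.
Qed.

Lemma artin_eq_cat (u u' v v' : word S) :
  artin_eq m u u' -> artin_eq m v v' -> artin_eq m (u ++ v) (u' ++ v').
Proof.
move=> uu' vv'; apply: (@ae_trans _ _ _ (u' ++ v)).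
  exact: (artin_eq_ctx [::] v uu').
by have := artin_eq_ctx u' [::] vv'; rewrite !cats0.
Qed.

Lemma artin_eq_altw u u' v v' k :
  artin_eq m u u' -> artin_eq m v v' ->
  artin_eq m (altw u v k) (altw u' v' k).
Proof.
elim: k u u' v v' => [|k IH] u u' v v' uu' vv' /=; first exact: ae_refl.
by apply: artin_eq_cat => //; apply: IH.
Qed.

(** The retraction fixes [x] and sends [c] to [w], so it carries the relation between [x] and [c] to
    one between [x] and [w]. *)
Lemma retraction_image (a b c : S) :
  retraction_onto m [set a; b] ->
  exists w, word_in [set a; b] w /\
    forall x k, x \in [set a; b] -> x != c -> m x c = Some k ->
      artin_eq m (altw [:: (x, false)] w k) (altw w [:: (x, false)] k).
Proof.
case=> f [f_eq [f_cat [f_in f_id]]].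
have [w [w_in fcw]] := f_in [:: (c, false)].
exists w; split=> // x k xab xc mxc.
have fx : artin_eq m (f [:: (x, false)]) [:: (x, false)].
  by apply: f_id; rewrite /word_in /= xab.
have f_alt u v j : artin_eq m (f (altw u v j)) (altw (f u) (f v) j).
  elim: j u v => [|j IH] u v /=; first exact: f_id.
  apply: ae_trans (f_cat _ _) _.
  by apply: artin_eq_cat; [apply: ae_refl | apply: IH].
have fxc : artin_eq m (f (alt x c k)) (f (alt c x k)).
  by apply: f_eq; have := ae_rel [::] [::] xc mxc; rewrite !cats0.
rewrite !altE in fxc.
apply: ae_trans (ae_trans fxc _).
  by apply: ae_sym; apply: ae_trans (f_alt _ _ _) _; apply: artin_eq_altw.
by apply: ae_trans (f_alt _ _ _) _; apply: artin_eq_altw.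
Qed.

Section Action.

Variables (Z : Type) (T T' : S -> Z -> Z).

Fixpoint act (w : word S) (z : Z) : Z :=
  if w is l :: w' then (if l.2 then T' l.1 else T l.1) (act w' z) else z.

Lemma act_cat u v z : act (u ++ v) z = act u (act v z).
Proof. by elim: u => //= l u ->. Qed.

Lemma act_altw u v k z : act (altw u v k) z = alternate (act u) (act v) k z.
Proof. by elim: k u v => //= k IH u v; rewrite act_cat IH. Qed.

Hypothesis TK : forall s, cancel (T s) (T' s).
Hypothesis T'K : forall s, cancel (T' s) (T s).
Hypothesis T_braid : forall s t k z, s != t -> m s t = Some k ->
  alternate (T s) (T t) k z = alternate (T t) (T s) k z.

Lemma act_artin_eq u v : artin_eq m u v -> act u =1 act v.
Proof.
elim=> {u v} [w|u v _ IH|u v w _ IH1 _ IH2|u v s b|u v s t k st mk] z //.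
- by rewrite IH1 IH2.
- rewrite !act_cat /=; congr act.
  by case: b => /=; rewrite ?TK ?T'K.
- rewrite !act_cat; congr act.
  rewrite !altE !act_altw.
  by apply: T_braid.
Qed.

End Action.

(* A_S need not act on Y: only the words in X preserve the image of f. *)
Lemma act_artin_eq_sub (Y Z : Type) (T T' : S -> Z -> Z) (U U' : S -> Y -> Y)
    (f : Y -> Z) (X : {set S}) :
  (forall s, cancel (T s) (T' s)) -> (forall s, cancel (T' s) (T s)) ->
  (forall s t k z, s != t -> m s t = Some k ->
     alternate (T s) (T t) k z = alternate (T t) (T s) k z) ->
  injective f -> (forall s, cancel (U' s) (U s)) ->
  (forall s y, s \in X -> T s (f y) = f (U s y)) ->
  forall u v, word_in X u -> word_in X v -> artin_eq m u v ->
  act U U' u =1 act U U' v.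
Proof.
move=> TK T'K T_braid f_inj U'K TU u v.
have fE w y : word_in X w -> act T T' w (f y) = f (act U U' w y).
  elim: w => //= -[s b] w IH /andP[/= sX wX]; rewrite IH //.
  by case: b; rewrite ?TU //= -{1}[act _ _ _ _](U'K s) -TU // TK.
by move=> uX vX uv y; apply: f_inj; rewrite -!fE //; apply: act_artin_eq.
Qed.

End Words.

(** * Braid relations between two affine maps of a plane *)

Section RankTwo.

Import GRing.Theory.
Local Open Scope ring_scope.

Variable K : fieldType.

(** The characteristic polynomial is (X - 1)(X - lam)(X - mu), and the three initial values exclude
    a component along the root 1. *)
Lemma linear_rec3 (lam mu A B : K) (d : nat -> K) :
  (forall j, d j.+3 = (lam + mu + 1) * d j.+2 - (lam + mu + lam * mu) * d j.+1
                      + lam * mu * d j) ->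
  (lam - mu) * d 0 = A - B ->
  (lam - mu) * d 1 = lam * A - mu * B ->
  (lam - mu) * d 2 = lam ^+ 2 * A - mu ^+ 2 * B ->
  forall j, (lam - mu) * d j = lam ^+ j * A - mu ^+ j * B.
Proof.
move=> rec d0 d1 d2 j.
have: [/\ (lam - mu) * d j = lam ^+ j * A - mu ^+ j * B,
          (lam - mu) * d j.+1 = lam ^+ j.+1 * A - mu ^+ j.+1 * B &
          (lam - mu) * d j.+2 = lam ^+ j.+2 * A - mu ^+ j.+2 * B].
  elim: j => [|j [IH0 IH1 IH2]]; first by rewrite !expr0 !mul1r.
  split=> //; rewrite rec.
  have -> : (lam - mu) *
      ((lam + mu + 1) * d j.+2 - (lam + mu + lam * mu) * d j.+1 + lam * mu * d j)
    = (lam + mu + 1) * ((lam - mu) * d j.+2)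
      - (lam + mu + lam * mu) * ((lam - mu) * d j.+1)
      + lam * mu * ((lam - mu) * d j) by ring.
  by rewrite IH0 IH1 IH2 !exprS; ring.
by case.
Qed.

Variables (q q' x y F F' : K).

(* On the plane v + <e_s, e_t>, with F = F_s(v) and F' = F_t(v), these are the
   generators s and t in the coordinates along e_s and e_t. *)
Definition planeL (p : K * K) := (p.1 - (F + (1 + q) * p.1 + x * p.2), p.2).
Definition planeR (p : K * K) := (p.1, p.2 - (F' + y * p.1 + (1 + q') * p.2)).

Let X := planeL \o planeR.
Let Y := planeR \o planeL.

Let rec3 (d : nat -> K) (lam mu : K) := forall j,
  d j.+3 = (lam + mu + 1) * d j.+2 - (lam + mu + lam * mu) * d j.+1
           + lam * mu * d j.

(** Cayley-Hamilton: the linear parts of [X] and [Y] both have determinant q q' and trace x y - q -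
    q', hence eigenvalues lam and mu. The extra root 1 accounts for the translations. *)
Let plane_rec3 lam mu (z z' : K * K) :
  lam * mu = q * q' -> x * y = lam + mu + q + q' ->
  rec3 (fun j => (iter j X z).1 - (iter j Y z').1) lam mu /\
  rec3 (fun j => (iter j X z).2 - (iter j Y z').2) lam mu.
Proof.
move=> eq_qq eq_xy; have tr : lam + mu = x * y - q - q' by rewrite eq_xy; ring.
rewrite /rec3 eq_qq tr.
split=> j; rewrite !iterS; case: (iter j X z) (iter j Y z') => [p1 p2] [p1' p2'];
by rewrite /X /Y /planeL /planeR /=; ring.
Qed.

Lemma plane_braid0 k : ~~ odd k -> x = 0 -> y = 0 -> forall z,
  alternate planeL planeR k z = alternate planeR planeL k z.
Proof.
move=> ev_k x0 y0 z; rewrite -[k]odd_double_half (negPf ev_k) !alternate_double.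
apply: eq_iter => -[p1 p2].
by rewrite /planeL /planeR /= x0 y0; congr pair; ring.
Qed.

(** Both orbits start at the origin, so in each coordinate their difference is d_1 (lam^j - mu^j) /
    (lam - mu), which vanishes at j = k. *)
Lemma plane_braid_even lam mu k :
  lam * mu = q * q' -> x * y = lam + mu + q + q' -> lam != mu ->
  lam ^+ k = mu ^+ k ->
  alternate planeL planeR k.*2 (0, 0) = alternate planeR planeL k.*2 (0, 0).
Proof.
move=> eq_qq eq_xy neq eq_k; rewrite !alternate_double -/X -/Y.
have nz : lam - mu != 0 by rewrite subr_eq0.
have [r1 r2] := plane_rec3 (0, 0) (0, 0) eq_qq eq_xy.
have tr : lam + mu = x * y - q - q' by rewrite eq_xy; ring.
have s1 := linear_rec3 (A := (X (0,0)).1 - (Y (0,0)).1)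
  (B := (X (0,0)).1 - (Y (0,0)).1) r1 _ _ _.
have s2 := linear_rec3 (A := (X (0,0)).2 - (Y (0,0)).2)
  (B := (X (0,0)).2 - (Y (0,0)).2) r2 _ _ _.
have sq : forall c, lam ^+ 2 * c - mu ^+ 2 * c = (lam - mu) * ((lam + mu) * c).
  by move=> c; ring.
have e1 : (iter k X (0, 0)).1 = (iter k Y (0, 0)).1.
  apply/eqP; rewrite -subr_eq0; apply/eqP; apply: (mulfI nz).
  rewrite s1 ?mulr0 ?eq_k ?subrr //; rewrite ?sq ?tr -?mulrBl /= ?subrr ?mulr0 //.
  by congr (_ * _); rewrite /= /planeL /planeR /=; ring.
have e2 : (iter k X (0, 0)).2 = (iter k Y (0, 0)).2.
  apply/eqP; rewrite -subr_eq0; apply/eqP; apply: (mulfI nz).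
  rewrite s2 ?mulr0 ?eq_k ?subrr //; rewrite ?sq ?tr -?mulrBl /= ?subrr ?mulr0 //.
  by congr (_ * _); rewrite /= /planeL /planeR /=; ring.
by rewrite (surjective_pairing (iter k X _)) e1 e2 -surjective_pairing.
Qed.

Lemma plane_braid_odd lam mu k :
  q' = q -> lam * mu = q * q -> x * y = lam + mu + q + q -> lam != mu ->
  lam ^+ k * (lam + q) = mu ^+ k * (mu + q) ->
  alternate planeL planeR k.*2.+1 (0, 0) = alternate planeR planeL k.*2.+1 (0, 0).
Proof.
move=> qq' eq_qq eq_xy neq eq_k; rewrite !alternate_doubleS -/X -/Y.
have nz : lam - mu != 0 by rewrite subr_eq0.
have [||r1 r2] := @plane_rec3 lam mu (planeL (0, 0)) (planeR (0, 0)).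
- by rewrite qq'.
- by rewrite qq'.
(* If c is the initial difference, the coefficients lam + q and mu + q are those that give d_0 = c
   and d_1 = (x y - q) c. *)
have s1 := linear_rec3 (A := (lam + q) * ((planeL (0,0)).1 - (planeR (0,0)).1))
  (B := (mu + q) * ((planeL (0,0)).1 - (planeR (0,0)).1)) r1 _ _ _.
have s2 := linear_rec3 (A := (lam + q) * ((planeL (0,0)).2 - (planeR (0,0)).2))
  (B := (mu + q) * ((planeL (0,0)).2 - (planeR (0,0)).2)) r2 _ _ _.
have E0 c : (lam + q) * c - (mu + q) * c = (lam - mu) * c by ring.
have E1 c : lam * ((lam + q) * c) - mu * ((mu + q) * c)
          = (lam - mu) * ((x * y - q) * c).
  by rewrite eq_xy; ring.
have E2 c : lam ^+ 2 * ((lam + q) * c) - mu ^+ 2 * ((mu + q) * c)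
          = (lam - mu) * (((x * y - q - q) * (x * y - q) - q * q) * c).
  by rewrite -eq_qq eq_xy; ring.
have e1 : (iter k X (planeL (0, 0))).1 = (iter k Y (planeR (0, 0))).1.
  apply/eqP; rewrite -subr_eq0; apply/eqP; apply: (mulfI nz).
  rewrite s1 ?E0 ?E1 ?E2 //.
  + by rewrite !mulrA eq_k subrr mulr0.
  + by congr (_ * _); rewrite /= /planeL /planeR /= qq'; ring.
  + by congr (_ * _); rewrite /= /planeL /planeR /= qq'; ring.
have e2 : (iter k X (planeL (0, 0))).2 = (iter k Y (planeR (0, 0))).2.
  apply/eqP; rewrite -subr_eq0; apply/eqP; apply: (mulfI nz).
  rewrite s2 ?E0 ?E1 ?E2 //.
  + by rewrite !mulrA eq_k subrr mulr0.
  + by congr (_ * _); rewrite /= /planeL /planeR /= qq'; ring.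
  + by congr (_ * _); rewrite /= /planeL /planeR /= qq'; ring.
by rewrite (surjective_pairing (iter k X _)) e1 e2 -surjective_pairing.
Qed.

End RankTwo.

(** * Braid relations between shears *)

Section Transvections.

Import GRing.Theory.
Local Open Scope ring_scope.

Variable K : fieldType.
Implicit Types (c d w u : K) (p : K * K).

(** Lower triangular matrices with second diagonal entry 1; for c nonzero they form a copy of the
    affine group of the line. *)
Definition shear c w p : K * K := (c * p.1, w * p.1 + p.2).

Lemma shear_comp c w c' w' p :
  shear c w (shear c' w' p) = shear (c * c') (w * c' + w') p.
Proof. by rewrite /shear /=; congr pair; ring. Qed.

Lemma shearK c w : c != 0 -> cancel (shear c^-1 (- w / c)) (shear c w).
Proof. by move=> c0 [p1 p2]; rewrite /shear /=; congr pair; field. Qed.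

Lemma scale_braid_odd c d n : c != 0 -> d != 0 ->
  alternate ( *%R c) ( *%R d) n.*2.+1 1 = alternate ( *%R d) ( *%R c) n.*2.+1 1 ->
  c = d.
Proof.
have altE c' d' : alternate ( *%R c') ( *%R d') n.*2.+1 1 = (c' * d') ^+ n * c'.
  rewrite alternate_doubleS; elim: n => [|n IH] /=; first by rewrite mulr1 mul1r.
  by rewrite IH exprS !mulrA.
move=> c0 d0; rewrite !altE [d * c]mulrC.
by apply: mulfI; rewrite expf_neq0 // mulf_neq0.
Qed.

Lemma shear_braid_odd c d w u n :
  c != 0 -> d != 0 ->
  alternate (shear c w) (shear d u) n.*2.+1 =1
    alternate (shear d u) (shear c w) n.*2.+1 ->
  c = d /\ (w - u) * (c ^+ n.*2.+1 + 1) = 0.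
Proof.
move=> c0 d0 eq_alt.
have fst_alt c' d' w' u' k p :
    (alternate (shear c' w') (shear d' u') k p).1 =
    alternate ( *%R c') ( *%R d') k p.1.
  exact/esym/alternate_morph.
have eq_cd : c = d.
  by apply: (@scale_braid_odd _ _ n) => //; have := congr1 fst (eq_alt (1, 0));
     rewrite !fst_alt.
split=> //; rewrite -{}eq_cd in eq_alt *.
(* The difference of second coordinates is a geometric sum of ratio -c; the factor 1 + c clears its
   denominator, so that c = -1 needs no separate case. *)
suff diff j : let P := alternate (shear c w) (shear c u) j (1, 0) in
    let Q := alternate (shear c u) (shear c w) j (1, 0) in
    [/\ P.1 = c ^+ j, Q.1 = c ^+ j &
        (P.2 - Q.2) * (1 + c) = (w - u) * (c ^+ j - (-1) ^+ j)].
  have [_ _] := diff n.*2.+1; rewrite eq_alt subrr mul0r => /esym.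
  by rewrite -signr_odd /= odd_double expr1 opprK.
elim: j => [|j [/= IH1 IH2 IH3]] /=; first by split; rewrite ?expr0 ?subrr ?mul0r ?mulr0.
split; rewrite ?IH1 ?IH2 ?exprS //.
have -> : (w * c ^+ j + (alternate (shear c u) (shear c w) j (1, 0)).2 -
     (u * c ^+ j + (alternate (shear c w) (shear c u) j (1, 0)).2)) * (1 + c)
  = (w - u) * c ^+ j * (1 + c)
    - ((alternate (shear c w) (shear c u) j (1, 0)).2
       - (alternate (shear c u) (shear c w) j (1, 0)).2) * (1 + c) by ring.
by rewrite IH3; ring.
Qed.

Lemma shear_braid_even c u n :
  alternate (shear c 0) (shear 1 u) n.*2 =1
    alternate (shear 1 u) (shear c 0) n.*2 ->
  u * (1 - c ^+ n) = 0.
Proof.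
move=> eq_alt.
suff diff j : let P := iter j (shear c 0 \o shear 1 u) (1, 0) in
    let Q := iter j (shear 1 u \o shear c 0) (1, 0) in
    [/\ P.1 = c ^+ j, Q.1 = c ^+ j & P.2 - Q.2 = u * (1 - c ^+ j)].
  by have [_ _ <-] := diff n; rewrite -!alternate_double eq_alt subrr.
elim: j => [|j [/= IH1 IH2 IH3]] /=; first by split; rewrite ?expr0 ?subrr ?mulr0.
split; rewrite ?IH1 ?IH2 ?exprS ?mul1r //.
rewrite !mul0r !add0r.
have -> (r s : K) : u * c ^+ j + r - (u * (c * c ^+ j) + s)
  = u * c ^+ j * (1 - c) + (r - s) by ring.
by rewrite IH3; ring.
Qed.

End Transvections.

(** * Representations by generalized reflections *)

Section Reflections.

Import GRing.Theory.
Local Open Scope ring_scope.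

(* lam and mu are the eigenvalues of the product of the two generators. *)
Definition braid_param (K : fieldType) (q q' x y : K) (k : nat) : Prop :=
  if odd k then
    q' = q /\ exists lam mu, [/\ lam * mu = q * q, x * y = lam + mu + q + q,
      lam != mu & lam ^+ k./2 * (lam + q) = mu ^+ k./2 * (mu + q)]
  else
    (x = 0 /\ y = 0) \/ exists lam mu, [/\ lam * mu = q * q',
      x * y = lam + mu + q + q', lam != mu & lam ^+ k./2 = mu ^+ k./2].

Lemma plane_braid (K : fieldType) (q q' x y F F' : K) k :
  braid_param q q' x y k ->
  alternate (planeL q x F) (planeR q' y F') k (0, 0) =
  alternate (planeR q' y F') (planeL q x F) k (0, 0).
Proof.
rewrite /braid_param; have := odd_double_half k; case: ifP => odd_k kE.
  case=> qq' [lam [mu [? ? ? ?]]].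
  by rewrite -kE; apply: (@plane_braid_odd _ _ _ _ _ _ _ lam mu).
case=> [[x0 y0]|[lam [mu [? ? ? ?]]]]; first by apply: plane_braid0; rewrite ?odd_k.
by rewrite -kE; apply: (@plane_braid_even _ _ _ _ _ _ _ lam mu).
Qed.

Lemma braid_param_root (K : fieldType) (q x y z : K) k :
  odd k -> q != 0 -> z != 1 -> z ^+ k = 1 -> x * y = q * (2 + z + z^-1) ->
  braid_param q q x y k.
Proof.
move=> odd_k q0 z1 zk xy; rewrite /braid_param odd_k; split=> //.
have z0 : z != 0.
  by apply: contraNneq (oner_neq0 K) => z0; rewrite -zk z0 expr0n; case: (k) odd_k.
have zj : z ^+ k./2 * z ^+ k./2 * z = 1.
  by rewrite -exprD addnn -exprSr -[X in _ = X]zk -{2}[k]odd_double_half odd_k.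
have zj0 : z ^+ k./2 != 0 by rewrite expf_neq0.
exists (q * z), (q / z); split.
- by field.
- by rewrite xy; ring.
(* Equal eigenvalues would give z^2 = 1, and z^k = 1 with k odd would then give z = 1. *)
- apply: contraNneq z1 => /(mulfI q0) zV.
  have z2 : z * z = 1 by rewrite {2}zV divff.
  by move: zj; rewrite -exprMn z2 expr1n mul1r => ->.
- rewrite !exprMn exprVn.
  have zjV : (z ^+ k./2)^-1 = z ^+ k./2 * z.
    by apply: (mulfI zj0); rewrite mulrA zj divff.
  by rewrite zjV; field.
Qed.

Variables (S : finType) (K : fieldType) (q : S -> K) (g : S -> S -> K).

Definition refl_form (s : S) (v : {ffun S -> K}) : K := \sum_t g s t * v t.

Definition bump (v : {ffun S -> K}) (s : S) (c : K) : {ffun S -> K} :=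
  [ffun t => v t + c * (t == s)%:R].

Definition refl (s : S) (v : {ffun S -> K}) := bump v s (- refl_form s v).
Definition reflV (s : S) (v : {ffun S -> K}) :=
  bump v s (- ((q s)^-1 * refl_form s v)).

Lemma refl_form_bump s t v c :
  refl_form s (bump v t c) = refl_form s v + g s t * c.
Proof.
rewrite /refl_form; under eq_bigr => r _ do rewrite ffunE mulrDr.
rewrite big_split /=; congr (_ + _).
rewrite (bigD1 t) //= eqxx mulr1 big1 ?addr0 // => r /negPf ->.
by rewrite !mulr0.
Qed.

Lemma bump_bump s v c d : bump (bump v s c) s d = bump v s (c + d).
Proof. by apply/ffunP => r; rewrite !ffunE mulrDl addrA. Qed.

Lemma bumpC s t v c d : bump (bump v s c) t d = bump (bump v t d) s c.
Proof. by apply/ffunP => r; rewrite !ffunE addrAC. Qed.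

Lemma bump0 s v : bump v s 0 = v.
Proof. by apply/ffunP => r; rewrite !ffunE mul0r addr0. Qed.

Hypothesis q_neq0 : forall s, q s != 0.
Hypothesis g_diag : forall s, g s s = 1 + q s.

Lemma reflK s : cancel (refl s) (reflV s).
Proof.
move=> v; rewrite /reflV refl_form_bump bump_bump g_diag.
rewrite [X in bump _ _ X](_ : _ = 0) ?bump0 //.
by have := q_neq0 s; move: (q s) (refl_form s v) => c d c0; field.
Qed.

Lemma reflVK s : cancel (reflV s) (refl s).
Proof.
move=> v; rewrite /refl refl_form_bump bump_bump g_diag.
rewrite [X in bump _ _ X](_ : _ = 0) ?bump0 //.
by have := q_neq0 s; move: (q s) (refl_form s v) => c d c0; field.
Qed.

Definition plane_pt (v : {ffun S -> K}) s t (p : K * K) :=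
  bump (bump v s p.1) t p.2.

Lemma refl_planeL v s t p : refl s (plane_pt v s t p) =
  plane_pt v s t (planeL (q s) (g s t) (refl_form s v) p).
Proof.
rewrite /refl !refl_form_bump g_diag /plane_pt bumpC bump_bump /planeL /=.
by rewrite bumpC.
Qed.

Lemma refl_planeR v s t p : refl t (plane_pt v s t p) =
  plane_pt v s t (planeR (q t) (g t s) (refl_form t v) p).
Proof.
by rewrite /refl !refl_form_bump g_diag /plane_pt bump_bump /planeR /=.
Qed.

Lemma plane_pt_inj v s t : s != t -> injective (plane_pt v s t).
Proof.
move=> st [p1 p2] [p1' p2'] /ffunP eq_p.
have /= := eq_p s; have /= := eq_p t; rewrite !ffunE !eqxx (negPf st).
rewrite [t == s]eq_sym (negPf st) /= !mulr0 !mulr1 !addr0.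
by move=> /addrI -> /addrI ->.
Qed.

Lemma refl_braid s t k v : braid_param (q s) (q t) (g s t) (g t s) k ->
  alternate (refl s) (refl t) k v = alternate (refl t) (refl s) k v.
Proof.
(* Each v is the origin of its own plane v + <e_s, e_t>, so the affine identity at (0, 0) is
   enough. *)
move=> bp; have -> : v = plane_pt v s t (0, 0) by rewrite /plane_pt !bump0.
rewrite (alternate_morph _ _ (refl_planeL v s t) (refl_planeR v s t)).
rewrite (alternate_morph _ _ (refl_planeR v s t) (refl_planeL v s t)).
by rewrite plane_braid.
Qed.

(** The plane through v = 0 is <e_s, e_t>, where both forms have constant term 0. The map [f]
    chooses coordinates on it, or on a stable line, in which [s] and [t] act simply. *)
Lemma act_plane_artin_eq (m : S -> S -> option nat) (Y : Type)
    (U U' : S -> Y -> Y) (f : Y -> K * K) s t :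
  (forall s t k, s != t -> m s t = Some k ->
     braid_param (q s) (q t) (g s t) (g t s) k) ->
  s != t -> injective f -> (forall r, cancel (U' r) (U r)) ->
  (forall y, planeL (q s) (g s t) 0 (f y) = f (U s y)) ->
  (forall y, planeR (q t) (g t s) 0 (f y) = f (U t y)) ->
  forall u v, word_in [set s; t] u -> word_in [set s; t] v -> artin_eq m u v ->
  act U U' u =1 act U U' v.
Proof.
move=> bp st f_inj U'K Us Ut.
have form0 r : refl_form r [ffun => 0] = 0.
  by rewrite /refl_form big1 // => i _; rewrite ffunE mulr0.
apply: (@act_artin_eq_sub _ _ _ _ refl reflV _ _ (plane_pt [ffun => 0] s t \o f)).
- exact: reflK.
- exact: reflVK.
- by move=> r r' k v rr' mk; apply: refl_braid; apply: bp.
- by apply: inj_comp f_inj; apply: plane_pt_inj.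
- exact: U'K.
- move=> r y; rewrite !inE => /orP[] /eqP -> /=.
    by rewrite refl_planeL form0 Us.
  by rewrite refl_planeR form0 Ut.
Qed.

End Reflections.

(** * Necessity: constraints on triples of generators *)

Definition odd_edge (S : finType) (m : S -> S -> option nat) (s t : S) : bool :=
  if m s t is Some k then odd k else false.

Section Necessity.

Import GRing.Theory Num.Theory.
Local Open Scope ring_scope.

(** The shift makes this total: at k = 0 the default is a primitive first root, namely 1. *)
Definition prim_root (k : nat) : algC :=
  sval (C_prim_root_exists (ltn0Sn k.-1)).

Lemma prim_rootP k : (0 < k)%N -> k.-primitive_root (prim_root k).
Proof. by case: k => // k _; rewrite /prim_root; case: C_prim_root_exists. Qed.

Variables (S : finType) (m : S -> S -> option nat).
Hypothesis hM : coxeter_matrix m.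
Hypothesis retr : parabolic_retractable m.

Let m_sym s t : m s t = m t s. Proof. by case: hM => _ []. Qed.

Lemma coxeter_gt1 s t k : s != t -> m s t = Some k -> (1 < k)%N.
Proof.
move=> st mst; case: hM => _ [_ /(_ s t st)]; rewrite mst.
by case=> [//|[k' [[->]]]].
Qed.

Lemma odd_edge_sym s t : odd_edge m s t = odd_edge m t s.
Proof. by rewrite /odd_edge m_sym. Qed.

(** The entries F_s(e_t). At an odd edge the square root shares the prescribed product equally
    between F_s(e_t) and F_t(e_s); [e] is the choice left at even and infinite entries. *)
Definition gram (q : S -> algC) (e : S -> S -> algC) s t : algC :=
  if s == t then 1 + q s
  else if m s t is Some k then
    if odd k then sqrtC (q s * (2 + prim_root k + (prim_root k)^-1)) else e s t
  else e s t.

Lemma gram_braid q e : (forall s, q s != 0) ->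
  (forall s t, odd_edge m s t -> q s = q t) ->
  (forall s t k, s != t -> m s t = Some k -> ~~ odd k ->
     braid_param (q s) (q t) (e s t) (e t s) k) ->
  forall s t k, s != t -> m s t = Some k ->
    braid_param (q s) (q t) (gram q e s t) (gram q e t s) k.
Proof.
move=> q0 q_odd e_even s t k st mst.
rewrite /gram [t == s]eq_sym (negPf st) [m t s]m_sym mst.
case: (boolP (odd k)) => [odd_k | ev_k]; last exact: e_even.
have <- : q s = q t by apply: q_odd; rewrite /odd_edge mst.
have k_gt1 := coxeter_gt1 st mst.
have zP := prim_rootP (ltnW k_gt1).
apply: (@braid_param_root _ _ _ _ (prim_root k)) => //.
- apply/eqP => z1.
  have := prim_order_dvd zP 1; rewrite z1 expr1n eqxx dvdn1.
  by case: (k) k_gt1 => [|[]].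
- exact: prim_expr_order zP.
- by rewrite -expr2 sqrtCK.
Qed.

Lemma act_scale (c : S -> algC) (w : word S) : (forall s, c s != 0) ->
  exists2 d, d != 0 & act (fun s => *%R (c s)) (fun s => *%R (c s)^-1) w =1 *%R d.
Proof.
move=> c0; elim: w => [|[s b] w [d d0 IH]] /=.
  by exists 1 => [|z]; rewrite ?oner_neq0 ?mul1r.
exists ((if b then (c s)^-1 else c s) * d).
  by rewrite mulf_neq0 //; case: b; rewrite ?invr_eq0.
by move=> z; rewrite IH; case: b; rewrite mulrA.
Qed.

Lemma odd_edge_trans_neq a b c : a != b -> a != c -> b != c ->
  odd_edge m a c -> odd_edge m b c -> odd_edge m a b.
Proof.
move=> ab ac bc; rewrite {1 2}/odd_edge.
case mac: (m a c) => [k|//] odd_k; case mbc: (m b c) => [n|//] odd_n.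
apply/negPn/negP => even_ab.
(* The stable line of e_a suffices: [a] acts on it by -1 and [b] by 1, whereas the odd relations
   force both scalars to be that of [w]. *)
have [w [w_in w_eq]] := retraction_image c (retr [set a; b]).
pose sc s : algC := if s == a then -1 else 1.
have sc0 s : sc s != 0 by rewrite /sc; case: ifP => _; rewrite ?oppr_eq0 oner_neq0.
pose g := gram (fun=> 1) (fun _ _ => 0).
have g_ab : g a b = 0 /\ g b a = 0.
  rewrite /g /gram [b == a]eq_sym (negPf ab) [m b a]m_sym.
  by move: even_ab; rewrite /odd_edge; case: (m a b) => // j /negPf ->.
have detect u v : word_in [set a; b] u -> word_in [set a; b] v ->
    artin_eq m u v -> act (fun s => *%R (sc s)) (fun s => *%R (sc s)^-1) u 1
                    = act (fun s => *%R (sc s)) (fun s => *%R (sc s)^-1) v 1.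
  move=> uX vX uv; move: {uv}(uX) (vX) uv (1 : algC).
  apply: (@act_plane_artin_eq _ _ (fun=> 1) g _ _ m _ _ _ (fun z => (z, 0)) a b) => //.
  - by move=> s; apply: oner_neq0.
  - by move=> s; rewrite /g /gram eqxx.
  - apply: gram_braid => // [s|s t j _ _ ev_j]; first exact: oner_neq0.
    by rewrite /braid_param (negPf ev_j); left.
  - by move=> z z' [].
  - by move=> s; apply: mulVKf.
  - by move=> z; rewrite /planeL /sc eqxx /= g_ab.1; congr pair; ring.
  - move=> z; rewrite /planeR /sc eq_sym (negPf ab) /= g_ab.2.
    by congr pair; ring.
have [d d0 act_w] := act_scale w sc0.
have scale_w x j : x \in [set a; b] -> x != c -> m x c = Some j -> odd j ->
    sc x = d.
  move=> xX xc mxc odd_j.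
  have x_in : word_in [set a; b] [:: (x, false)] by rewrite /word_in /= xX.
  have := detect _ _ (word_in_altw j x_in w_in) (word_in_altw j w_in x_in)
    (w_eq x j xX xc mxc).
  rewrite !act_altw -[j]odd_double_half odd_j add1n.
  rewrite (eq_alternate _ (frefl _) act_w) (eq_alternate _ act_w (frefl _)).
  exact: scale_braid_odd.
have := scale_w a k; rewrite !inE eqxx => /(_ isT ac mac odd_k).
have := scale_w b n; rewrite !inE eqxx orbT => /(_ isT bc mbc odd_n) <-.
rewrite /sc eqxx eq_sym (negPf ab) => /eqP; rewrite eq_sym -subr_eq0 opprK.
by rewrite (pnatr_eq0 _ 2).
Qed.

Lemma odd_edgexx s : odd_edge m s s.
Proof. by rewrite /odd_edge (hM.1 s). Qed.

Lemma odd_edge_trans s t r : odd_edge m s t -> odd_edge m t r -> odd_edge m s r.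
Proof.
have [<-//|sr] := eqVneq s r; first by rewrite odd_edgexx.
have [<-//|st] := eqVneq s t; have [<-//|tr] := eqVneq t r.
rewrite [odd_edge m t r]odd_edge_sym => *.
by apply: (@odd_edge_trans_neq s r t) => //; rewrite eq_sym.
Qed.

Lemma act_shear (c e : S -> algC) (w : word S) : (forall s, c s != 0) ->
  exists d u, d != 0 /\
    act (fun s => shear (c s) (e s)) (fun s => shear (c s)^-1 (- e s / c s)) w
    =1 shear d u.
Proof.
move=> c0; elim: w => [|[s b] w [d [u [d0 IH]]]] /=.
  exists 1, 0; split=> [|[z1 z2]]; first exact: oner_neq0.
  by rewrite /shear /= mul1r mul0r add0r.
pose c1 := if b then (c s)^-1 else c s.
pose e1 := if b then - e s / c s else e s.
exists (c1 * d), (e1 * d + u); split=> [|z].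
  by rewrite mulf_neq0 // /c1; case: b {c1 e1}; rewrite ?invr_eq0.
by rewrite IH /c1 /e1; case: b {c1 e1}; rewrite shear_comp.
Qed.

(** In a representation of A_{a,b} by shears, the image of [r] is a single unknown shear that
    inherits the relations of [r] with [a] and [b]. *)
Lemma retraction_shear (c e : S -> algC) a b r : (forall s, c s != 0) ->
  (forall u v, word_in [set a; b] u -> word_in [set a; b] v -> artin_eq m u v ->
     act (fun s => shear (c s) (e s)) (fun s => shear (c s)^-1 (- e s / c s)) u =1
     act (fun s => shear (c s) (e s)) (fun s => shear (c s)^-1 (- e s / c s)) v) ->
  exists d u, d != 0 /\
    forall x k, x \in [set a; b] -> x != r -> m x r = Some k ->
      alternate (shear (c x) (e x)) (shear d u) k =1
      alternate (shear d u) (shear (c x) (e x)) k.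
Proof.
move=> c0 detect.
have [w [w_in w_eq]] := retraction_image r (retr [set a; b]).
have [d [u [d0 act_w]]] := act_shear e w c0.
exists d, u; split=> // x k xX xr mxr z.
have x_in : word_in [set a; b] [:: (x, false)] by rewrite /word_in /= xX.
have := detect _ _ (word_in_altw k x_in w_in) (word_in_altw k w_in x_in)
  (w_eq x k xX xr mxr) z.
by rewrite !act_altw (eq_alternate _ (frefl _) act_w)
           (eq_alternate _ act_w (frefl _)).
Qed.

Lemma even_edge_root a b c (beta : algC) n : a != c -> odd_edge m a c ->
  ~~ odd_edge m a b -> beta != 0 ->
  (forall k, m a b = Some k -> beta != 1 /\ beta ^+ k./2 = 1) ->
  m b c = Some n.*2 -> beta ^+ n = 1.
Proof.
move=> ac odd_ac even_ab beta0 betaP mbc.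
have ba : b != a by apply: contraNneq even_ab => ->; apply: odd_edgexx.
have bc : b != c by apply: contraNneq even_ab => ->.
(* [q] must be constant along odd edges, hence the class of [a]. The only nonzero value of [e] is at
   (a, b), so F_s(e_t) F_t(e_s) = 0 at every even edge. *)
pose q s := if odd_edge m a s then -1 else - beta.
pose e s t : algC := ((s == a) && (t == b))%:R.
pose g := gram q e.
have gab : g a b = 1.
  rewrite /g /gram [a == b]eq_sym (negPf ba) /e !eqxx.
  by move: even_ab; rewrite /odd_edge; case: (m a b) => // j /negPf ->.
have gba : g b a = 0.
  rewrite /g /gram (negPf ba) /e (negPf ba) m_sym.
  by move: even_ab; rewrite /odd_edge; case: (m a b) => // j /negPf ->.
have qa : q a = -1 by rewrite /q odd_edgexx.
have qb : q b = - beta by rewrite /q (negPf even_ab).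
pose cc s := if s == a then 1 else beta.
pose ee s : algC := if s == a then -1 else 0.
have cc0 s : cc s != 0 by rewrite /cc; case: ifP => // _; apply: oner_neq0.
have q0 s : q s != 0 by rewrite /q; case: ifP => _; rewrite oppr_eq0 ?oner_neq0.
(* The basis is taken in the order e_b, e_a, which makes both generators lower triangular. *)
have [|d [u [d0 braid]]] := @retraction_shear cc ee b a c cc0.
  apply: (@act_plane_artin_eq _ _ q g _ _ m _ _ _ id b a) => //.
  - by move=> s; rewrite /g /gram eqxx.
  - apply: gram_braid => // [s t odd_st|s t k st mst ev_k].
      rewrite /q; suff -> : odd_edge m a s = odd_edge m a t by [].
      apply/idP/idP => ?; first exact: odd_edge_trans odd_st.
      by apply: (@odd_edge_trans a t s) => //; rewrite odd_edge_sym.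
    have root_ab : m a b = Some k -> forall x y, x * y = 0 ->
        braid_param (- beta) (-1) x y k /\ braid_param (-1) (- beta) x y k.
      move=> /betaP [beta1 betak] x y xy; rewrite /braid_param (negPf ev_k).
      (* The eigenvalues 1 and beta cancel q + q' = -1 - beta, in agreement with x y = 0. *)
      by split; right; exists 1, beta; rewrite expr1n betak eq_sym; split=> //;
         rewrite ?xy; ring.
    case: (eqVneq s a) => [sa|sa].
      rewrite sa in st mst *; case: (eqVneq t b) => [tb|tb].
        rewrite tb in mst *; rewrite qa qb.
        by apply: (root_ab mst _ _ _).2; rewrite /e (negPf ba) andFb mulr0.
      by rewrite /braid_param (negPf ev_k) /e (negPf tb) andbF eq_sym (negPf st);
         left.
    case: (eqVneq t a) => [ta|ta].
      rewrite ta in st mst *; case: (eqVneq s b) => [sb|sb].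
        rewrite sb m_sym in mst *; rewrite qa qb.
        by apply: (root_ab mst _ _ _).1; rewrite /e (negPf ba) andFb mul0r.
      by rewrite /braid_param (negPf ev_k) /e (negPf sb) andbF (negPf sa); left.
    by rewrite /braid_param (negPf ev_k) /e (negPf sa) (negPf ta); left.
  - by move=> s; apply: shearK.
  - move=> [p1 p2]; rewrite /planeL /shear /cc /ee (negPf ba) gba qb /=.
    by congr pair; ring.
  - move=> [p1 p2]; rewrite /planeR /shear /cc /ee eqxx gab qa /=.
    by congr pair; ring.
have [k mac odd_k] : exists2 k, m a c = Some k & odd k.
  by move: odd_ac; rewrite /odd_edge; case: (m a c) => // k; exists k.
(* The odd relation with [a] identifies the unknown shear with that of [a]; the even relation with
   [b] then yields beta^n = 1. *)
have := braid a k; rewrite !inE eqxx orbT => /(_ isT ac mac).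
rewrite /cc /ee eqxx -[k]odd_double_half odd_k add1n.
move=> /(shear_braid_odd (oner_neq0 _) d0) [d1].
rewrite expr1n => /eqP; rewrite mulf_eq0 (pnatr_eq0 _ 2) orbF subr_eq0 => /eqP u1.
have := braid b n.*2; rewrite !inE eqxx => /(_ isT bc mbc).
rewrite /cc /ee (negPf ba) -d1 -u1 => /shear_braid_even /eqP.
by rewrite mulf_eq0 oppr_eq0 oner_eq0 subr_eq0 => /eqP.
Qed.

Lemma even_edge_dvd a b c n : a != c -> odd_edge m a c -> ~~ odd_edge m a b ->
  m b c = Some n.*2 -> exists2 l, m a b = Some l.*2 & (l %| n)%N.
Proof.
move=> ac odd_ac even_ab mbc.
have bc : b != c by apply: contraNneq even_ab => ->.
have n_gt0 : (0 < n)%N by have := coxeter_gt1 bc mbc; case: (n).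
have ab : a != b by apply: contraNneq even_ab => <-; apply: odd_edgexx.
case mab: (m a b) => [k|]; last first.
  have /eqP : (2 : algC) ^+ n = 1.
    by apply: (even_edge_root ac odd_ac even_ab _ _ mbc); rewrite ?pnatr_eq0 ?mab.
  rewrite -natrX (eqr_nat _ _ 1) -(expn0 2) eqn_exp2l // => /eqP n0.
  by rewrite n0 in n_gt0.
have k_gt1 := coxeter_gt1 ab mab.
have ev_k : ~~ odd k by move: even_ab; rewrite /odd_edge mab.
have kE : k = k./2.*2 by rewrite -{1}[k]odd_double_half (negPf ev_k).
exists k./2; first by rewrite -kE.
have k2_gt0 : (0 < k./2)%N by move: k_gt1; rewrite kE; case: (k./2).
have zP := prim_rootP k2_gt0.
(* For l = 1 the primitive root is 1, which [even_edge_root] does not allow as beta. *)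
have [->|k2_neq1] := eqVneq k./2 1%N; first exact: dvd1n.
rewrite (prim_order_dvd zP); apply/eqP.
apply: (even_edge_root ac odd_ac even_ab _ _ mbc).
  by rewrite (prim_root_eq0 zP) -lt0n.
move=> k'; rewrite mab => -[<-]; split; last exact: prim_expr_order zP.
apply: contraNneq k2_neq1 => z1.
by have := prim_order_dvd zP 1; rewrite z1 expr1n eqxx dvdn1.
Qed.

(** [even_edge_dvd] applies with [a] and [c] in either order: if one entry is finite so is the
    other, and their halves divide each other. *)
Lemma odd_edge_cross a b c : odd_edge m a c -> ~~ odd_edge m a b ->
  m a b = m c b.
Proof.
have [->//|ac] := eqVneq a c => odd_ac even_ab.
have odd_ca : odd_edge m c a by rewrite odd_edge_sym.
have even_cb : ~~ odd_edge m c b.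
  by apply: contraNN even_ab => odd_cb; apply: odd_edge_trans odd_cb.
have half s k : m s b = Some k -> ~~ odd_edge m s b -> m b s = Some k./2.*2.
  rewrite /odd_edge m_sym => -> ev_k.
  by rewrite -{1}[k]odd_double_half (negPf ev_k).
case mab: (m a b) => [k|]; case mcb: (m c b) => [n|] //.
- have [l ml l_dvd] := even_edge_dvd ac odd_ac even_ab (half _ _ mcb even_cb).
  have ca : c != a by rewrite eq_sym.
  have [l' ml' l'_dvd] := even_edge_dvd ca odd_ca even_cb (half _ _ mab even_ab).
  move: ml ml'; rewrite mab mcb => -[kE] [nE].
  rewrite kE nE !doubleK in l_dvd l'_dvd *.
  by congr (Some _.*2); apply/eqP; rewrite eqn_dvd l_dvd.
- have ca : c != a by rewrite eq_sym.
  have [l' ml' _] := even_edge_dvd ca odd_ca even_cb (half _ _ mab even_ab).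
  by rewrite mcb in ml'.
- have [l ml _] := even_edge_dvd ac odd_ac even_ab (half _ _ mcb even_cb).
  by rewrite mab in ml.
Qed.

Lemma odd_triangle_dvd a b c p k n : a != b -> a != c -> b != c ->
  m a b = Some p -> m a c = Some k -> m b c = Some n ->
  odd p -> odd k -> odd n -> (p %| k)%N || (p %| n)%N.
Proof.
move=> ab ac bc mab mac mbc odd_p odd_k odd_n.
have p_gt1 := coxeter_gt1 ab mab.
have zP := prim_rootP (ltnW p_gt1); set z := prim_root p in zP.
have z0 : z != 0 by rewrite (prim_root_eq0 zP) -lt0n ltnW.
have z1 : 1 + z != 0.
  apply/negP; rewrite addrC addr_eq0 => /eqP zN.
  have := prim_expr_order zP; rewrite zN -signr_odd odd_p expr1 => /eqP.
  by rewrite eq_sym -subr_eq0 opprK (pnatr_eq0 _ 2).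
pose q (s : S) : algC := z.
pose g := gram q (fun _ _ => 0).
(* As z (2 + z + 1/z) = (1 + z)^2, the Gram determinant of the plane vanishes. *)
have gg : g a b * g b a = (1 + z) * (1 + z).
  rewrite /g /gram [b == a]eq_sym (negPf ab) [m b a]m_sym mab odd_p.
  by rewrite /q -[LHS]expr2 sqrtCK -/z; field.
pose eta := g b a / (1 + z).
have eta0 : eta != 0.
  rewrite mulf_neq0 ?invr_eq0 //.
  by apply: contraTneq (mulf_neq0 z1 z1) => gba; rewrite -gg gba mulr0 eqxx.
pose ee s := if s == b then eta else 0.
have q0 s : q s != 0 by [].
have nz0 : - z != 0 by rewrite oppr_eq0.
have [|d [u [d0 braid]]] := @retraction_shear (fun=> - z) ee a b c (fun=> nz0).
  (* The second basis vector g a b e_a - (1 + z) e_b is killed by both forms. *)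
  pose f (v : algC * algC) := (v.1 + g a b * v.2, - (1 + z) * v.2).
  have g_ab : g a b * eta = 1 + z by rewrite /eta mulrA gg mulfK.
  apply: (@act_plane_artin_eq _ _ q g _ _ m _ _ _ f a b) => //.
  - by move=> s; rewrite /g /gram eqxx.
  - apply: gram_braid => // s t j _ _ ev_j.
    by rewrite /braid_param (negPf ev_j); left.
  - move=> [v1 v2] [v1' v2'] [] e1 /(mulfI _) e2.
    have e2' : v2 = v2' by apply: e2; rewrite oppr_eq0.
    by move: e1; rewrite e2' => /addIr ->.
  - by move=> s; apply: shearK; rewrite oppr_eq0.
  - move=> [v1 v2]; rewrite /planeL /f /shear /ee (negPf ab) /q /=.
    by congr pair; ring.
  - move=> [v1 v2]; rewrite /planeR /f /shear /ee eqxx /q /=; congr pair.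
      rewrite mulrDr mulrA g_ab; ring.
    rewrite mulrDr [g b a * (_ * _)]mulrA [g b a * g a b]mulrC gg /eta.
    by field.
(* For j odd, (-z)^j + 1 = 1 - z^j vanishes only if p divides j; otherwise [u] is the shear
   coefficient of [x], which is 0 for [a] and [eta] for [b]. *)
have root_or x j : x \in [set a; b] -> x != c -> m x c = Some j -> odd j ->
    (p %| j)%N || (u == ee x).
  move=> xX xc mxc odd_j; have := braid x j xX xc mxc.
  rewrite -{1 2}[j]odd_double_half odd_j add1n => /(shear_braid_odd nz0 d0) [_].
  have -> : j./2.*2.+1 = j by rewrite -{2}[j]odd_double_half odd_j.
  rewrite exprNn -signr_odd odd_j expr1 mulN1r [_ + 1]addrC => /eqP.
  by rewrite mulf_eq0 !subr_eq0 orbC (prim_order_dvd zP) eq_sym [u == _]eq_sym.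
have := root_or a k; rewrite !inE eqxx => /(_ isT ac mac odd_k) /orP[->//|/eqP ua].
have := root_or b n; rewrite !inE eqxx orbT => /(_ isT bc mbc odd_n).
case/orP=> [->|]; first by rewrite orbT.
by rewrite ua /ee (negPf ab) eqxx eq_sym (negPf eta0).
Qed.

End Necessity.

(** * Necessity: the partition into classes of [odd_edge] *)

Lemma retractable_compatible (S : finType) (m : S -> S -> option nat) :
  coxeter_matrix m -> parabolic_retractable m -> parabolic_retract_compatible m.
Proof.
move=> hM retr.
have eq_odd : {in [set: S] & &, equivalence_rel (odd_edge m)}.
  move=> s t r _ _ _; split=> [|st]; first exact: odd_edgexx.
  have ts : odd_edge m t s by rewrite odd_edge_sym.
  by apply/idP/idP => ?; [apply: odd_edge_trans ts _ | apply: odd_edge_trans st _].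
pose P := equivalence_partition (odd_edge m) [set: S].
have partP : partition P [set: S] by apply: equivalence_partitionP.
have same T s t : T \in P -> s \in T -> t \in T -> odd_edge m s t.
  case/imsetP=> r _ ->; rewrite !inE /= => rs rt.
  by apply: (odd_edge_trans hM retr _ rt); rewrite odd_edge_sym.
have close T s t : T \in P -> s \in T -> odd_edge m s t -> t \in T.
  case/imsetP=> r _ ->; rewrite !inE /= => rs st.
  exact: odd_edge_trans rs st.
have val T s t : T \in P -> s \in T -> t \in T ->
    exists2 k, m s t = Some k & odd k.
  move=> TP sT tT; have := same T s t TP sT tT.
  by rewrite /odd_edge; case: (m s t) => // k; exists k.
have m_sym s t : m s t = m t s by case: hM => _ [].
exists P; split=> //; split.
  move=> T TP; split=> [s t sT tT|a b c aT bT cT ab ac bc].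
    by have [k ? ?] := val T s t TP sT tT; exists k.
  have [p mab odd_p] := val T a b TP aT bT.
  have [k mac odd_k] := val T a c TP aT cT.
  have [n mbc odd_n] := val T b c TP bT cT.
  have ba : b != a by rewrite eq_sym.
  have ca : c != a by rewrite eq_sym.
  have cb : c != b by rewrite eq_sym.
  have mba : m b a = Some p by rewrite m_sym.
  have mca : m c a = Some k by rewrite m_sym.
  have mcb : m c b = Some n by rewrite m_sym.
  have p_dvd := odd_triangle_dvd hM retr ab ac bc mab mac mbc odd_p odd_k odd_n.
  have k_dvd := odd_triangle_dvd hM retr ac ab cb mac mab mcb odd_k odd_p odd_n.
  have n_dvd := odd_triangle_dvd hM retr bc ba ca mbc mba mca odd_n odd_p odd_k.
  have [pk|pk] := eqVneq p k.
    left; split; first by rewrite mab mac pk.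
    by exists n, p; do !split=> //; move: n_dvd; rewrite -pk orbb.
  have [pn|pn] := eqVneq p n.
    right; right; left; split; first by rewrite mba mbc pn.
    by exists k, p; do !split=> //; move: k_dvd; rewrite -pn orbb.
  have [kn|kn] := eqVneq k n.
    right; right; right; right; left; split; first by rewrite mca mcb kn.
    by exists p, k; do !split=> //; move: p_dvd; rewrite -kn orbb.
  (* Each of three distinct entries divides another one, so there is a cycle of divisibilities,
     which forces two of them to be equal. *)
  exfalso; have := pk; have := pn; have := kn; rewrite !eqn_dvd.
  case/orP: p_dvd => p_dvd; case/orP: k_dvd => k_dvd; case/orP: n_dvd => n_dvd;
  by rewrite ?p_dvd ?k_dvd ?n_dvd ?(dvdn_trans n_dvd k_dvd)
             ?(dvdn_trans n_dvd p_dvd) ?(dvdn_trans k_dvd n_dvd)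
             ?(dvdn_trans k_dvd p_dvd) ?(dvdn_trans p_dvd k_dvd)
             ?(dvdn_trans p_dvd n_dvd).
move=> T1 T2 T1P T2P T12.
have nonempty T : T \in P -> exists x, x \in T.
  move=> TP; apply/set0Pn; case/and3P: partP => _ _.
  by apply: contraNneq => <-.
have far a b : a \in T1 -> b \in T2 -> ~~ odd_edge m a b.
  move=> aT bT; apply: contraNN T12 => ab; case/and3P: partP => _ tI _.
  have bT1 := close _ _ _ T1P aT ab.
  by rewrite -(def_pblock tI T1P bT1) (def_pblock tI T2P bT).
have [[a0 a0T] [b0 b0T]] := (nonempty _ T1P, nonempty _ T2P).
exists (m a0 b0); split.
  have := far _ _ a0T b0T; rewrite /odd_edge; case: (m a0 b0) => [e|]; last by left.
  by move=> ev; right; exists e.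
move=> a b aT bT.
rewrite (odd_edge_cross hM retr (same _ _ _ T1P aT a0T)) ?far // m_sym [RHS]m_sym.
rewrite (odd_edge_cross hM retr (same _ _ _ T2P bT b0T)) //.
by rewrite odd_edge_sym ?far.
Qed.

(** * Sufficiency: retractions defined on generators *)

Section Sufficiency.

Variables (S : finType) (m : S -> S -> option nat).
Hypothesis hM : coxeter_matrix m.

Let m_sym s t : m s t = m t s. Proof. by case: hM => _ []. Qed.

(** Both words are cut into blocks of length k, and the relation is applied to each; when k is odd,
    successive blocks exchange [u] and [v]. *)
Lemma altw_dvd (u v : word S) k n : k %| n ->
  artin_eq m (altw u v k) (altw v u k) -> artin_eq m (altw u v n) (altw v u n).
Proof.
case/dvdnP=> j -> {n} uv; elim: j => [|j IH]; first exact: ae_refl.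
have altwD x y i n : altw x y (i + n) =
    altw x y i ++ (if odd i then altw y x n else altw x y n).
  elim: i x y => //= i IHi x y; rewrite IHi catA; by case: (odd i).
rewrite mulSn !altwD; apply: artin_eq_cat => //.
by case: (odd k) => //; apply: ae_sym.
Qed.

(* The points c of T outside Y are removed one at a time, each being sent to a
   remaining point y with m c y minimal. *)
Lemma nearest_point_map (T Y : {set S}) : retract_compatible m T ->
  Y \subset T -> Y != set0 ->
  exists f : S -> S, [/\ {in T, forall s, f s \in Y}, {in Y, f =1 id} &
    {in T &, forall s t k n, m s t = Some n -> m (f s) (f t) = Some k -> k %| n}].
Proof.
move=> [oddT tri]; move: {2}#|T :\: Y| (leqnn #|T :\: Y|) => N.
elim: N Y => [|N IH] Y leN YT Y0.
  have TY : T \subset Y by rewrite -setD_eq0 -cards_eq0 -leqn0.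
  exists id; split=> // [s /(subsetP TY)//|s t _ _ k n -> [->] //].
have [TY|[c]] := set_0Vmem (T :\: Y).
  by apply: IH => //; rewrite TY cards0.
rewrite inE => /andP[cY cT].
have {leN} leN : #|T :\: (c |: Y)| <= N.
  by move: leN; rewrite setUC -setDDl (cardsD1 c) inE cY cT.
have cYT : c |: Y \subset T by rewrite subUset sub1set cT.
have [|f [fY f_id f_dvd]] := IH _ leN cYT.
  by apply/set0Pn; exists c; rewrite !inE eqxx.
have /set0Pn[y0 y0Y] := Y0.
(* The default 0 is never taken on [Y], since all entries over [T] are finite. *)
pose d y := odflt 0 (m c y).
case: (@arg_minnP _ y0 (mem Y) d y0Y) => y yY y_min.
have yT := subsetP YT y yY.
have cy : c != y by apply: contraNneq cY => ->.
have val s t : s \in T -> t \in T -> exists k, m s t = Some k.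
  by move=> sT tT; have [k [? _]] := oddT s t sT tT; exists k.
have y_dvd t k n : t \in Y -> m c t = Some n -> m y t = Some k -> k %| n.
  move=> tY mct myt; have tT := subsetP YT t tY.
  have ct : c != t by apply: contraNneq cY => ->.
  have [yt|yt] := eqVneq y t.
    by move: myt; rewrite yt (hM.1 t) => -[<-].
  have [r mcy] := val c y cT yT.
  have r_le : r <= n by have := y_min t tY; rewrite /d mcy mct.
  have n_gt0 : 0 < n.
    by have [j [mj oj]] := oddT c t cT tT; move: mj; rewrite mct => -[->]; case: (j) oj.
  have mtc : m t c = Some n by rewrite m_sym.
  have mty : m t y = Some k by rewrite m_sym.
  have myc : m y c = Some r by rewrite m_sym.
  have := tri c y t cT yT tT cy ct yt; rewrite /rc_triple.
  rewrite mct myt mcy mtc mty myc.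
  (* The one shape of triangle that needs minimality: r = k and n divides k, whence n <= k = r <=
     n. *)
  have k_n p q : Some p = Some n -> Some k = Some q -> r = k -> p %| q -> k %| n.
    move=> [->] [<-] rk n_k; have := dvdn_leq _ n_k.
    have r_gt0 : 0 < r.
      by have [j [mj oj]] := oddT c y cT yT; move: mj; rewrite mcy => -[->]; case: (j) oj.
    rewrite -rk => /(_ r_gt0) n_r; rewrite rk in r_le n_r *.
    by have -> : k = n by apply/eqP; rewrite eqn_leq r_le n_r.
  by do 5?case; move=> [[e] [p [q [[ep] [[eq] pq]]]]]; subst => //;
     apply: (k_n _ _ erefl erefl erefl).
pose h s := if f s == c then y else f s.
have hY s : s \in T -> h s \in Y.
  move=> sT; rewrite /h; case: eqP => // fc.
  by have := fY s sT; rewrite !inE => /orP[/eqP|].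
exists h; split=> // [s sY|s t sT tT k n mst].
  rewrite /h f_id ?inE ?sY ?orbT //; case: eqP => // sc.
  by rewrite -sc sY in cY.
have [j mf] := val (f s) (f t) (subsetP cYT _ (fY _ sT)) (subsetP cYT _ (fY _ tT)).
have j_n := f_dvd s t sT tT _ _ mst mf.
rewrite /h; case: eqP => [fs|fs]; case: eqP => [ft|ft] mh.
- by move: mh; rewrite (hM.1 y) => -[<-].
- apply: dvdn_trans j_n; apply: (y_dvd (f t)) => //; last by rewrite -fs.
  by have := fY t tT; rewrite !inE => /orP[/eqP|].
- apply: dvdn_trans j_n; apply: (y_dvd (f s)); last by rewrite m_sym.
    by have := fY s sT; rewrite !inE => /orP[/eqP|].
  by rewrite m_sym -ft.
- by move: mh; rewrite mf => -[<-].
Qed.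

(** An even relation has equally many factors of both kinds on each side, so it survives when one
    generator is sent to 1. *)
Lemma altw_nil (u : word S) k : ~~ odd k -> altw u [::] k = altw [::] u k.
Proof.
move=> ev_k; rewrite -[k]odd_double_half (negPf ev_k) add0n.
by elim: k./2 => //= n ->.
Qed.

(** [None] stands for the identity element: the letter is erased. *)
Definition letter_map (f : S -> option S) : word S -> word S :=
  pmap (fun l : letter S => omap (fun s => (s, l.2)) (f l.1)).

Lemma letter_map_artin_eq f :
  (forall s t k, s != t -> m s t = Some k ->
     artin_eq m (letter_map f (alt s t k)) (letter_map f (alt t s k))) ->
  forall u v, artin_eq m u v -> artin_eq m (letter_map f u) (letter_map f v).
Proof.
move=> f_rel u v; elim=> {u v} [w|u v _ IH|u v w _ IH1 _ IH2|u v s b|u v s t k st mk].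
- exact: ae_refl.
- exact: ae_sym.
- exact: ae_trans IH1 IH2.
- rewrite /letter_map !pmap_cat /=; case: (f s) => [s'|] /=; last exact: ae_refl.
  exact: ae_free.
- by rewrite /letter_map !pmap_cat; apply/artin_eq_ctx/f_rel.
Qed.

Lemma compatible_retractable :
  parabolic_retract_compatible m -> parabolic_retractable m.
Proof.
case=> P [partP [rcP crossP]] X.
have [tI covP] : trivIset P /\ forall s, s \in cover P.
  by case/and3P: partP => /eqP -> ? _; split.
have block s : pblock P s \in P by rewrite pblock_mem.
have in_block s : s \in pblock P s by rewrite mem_pblock.
(* The conditions stay under the existential so that [fin_all_exists] can choose [h] for all [T] at
   once. *)
have ex_h T : exists h : S -> S, T \in P -> X :&: T != set0 ->
    [/\ {in T, forall s, h s \in X :&: T}, {in X :&: T, h =1 id} &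
    {in T &, forall s t k n, m s t = Some n -> m (h s) (h t) = Some k -> k %| n}].
  case: (boolP (T \in P)) => [TP|_]; last by exists id.
  have [_|XT] := eqVneq (X :&: T) set0; first by exists id.
  by have [f fP] := nearest_point_map (rcP T TP) (subsetIr X T) XT; exists f.
have [h hP] := fin_all_exists ex_h.
pose f s := if X :&: pblock P s == set0 then None else Some (h (pblock P s) s).
have fP s s' : f s = Some s' -> s' \in X :&: pblock P s.
  rewrite /f; case: eqVneq => // XT [<-].
  by have [hX _ _] := hP _ (block s) XT; apply: hX.
have f_id s : s \in X -> f s = Some s.
  move=> sX; have sXT : s \in X :&: pblock P s by rewrite inE sX in_block.
  have XT : X :&: pblock P s != set0 by apply/set0Pn; exists s.
  by rewrite /f (negPf XT); have [_ h_id _] := hP _ (block s) XT; rewrite h_id.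
exists (letter_map f); split; [|split; [|split]].
- apply: letter_map_artin_eq => s t k st mst.
  have f_altw u v : letter_map f (altw u v k) = altw (letter_map f u) (letter_map f v) k.
    by elim: k {mst} u v => //= k IH u v; rewrite -IH; apply: pmap_cat.
  rewrite !altE !f_altw /letter_map /=.
  have [Tst|Tst] := eqVneq (pblock P s) (pblock P t).
    rewrite /f -Tst; case: eqVneq => [_|XT] /=; first exact: ae_refl.
    have [hX _ h_dvd] := hP _ (block s) XT.
    have tT : t \in pblock P s by rewrite Tst.
    have [<-|h_st] := eqVneq (h (pblock P s) s) (h (pblock P s) t).
      exact: ae_refl.
    have /setIP[_ hs] := hX s (in_block s); have /setIP[_ ht] := hX t tT.
    have [j [mh _]] := (rcP _ (block s)).1 _ _ hs ht.
    apply: (altw_dvd (h_dvd s t (in_block s) tT _ _ mst mh)).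
    by rewrite -!altE; have := ae_rel [::] [::] h_st mh; rewrite !cats0.
  (* Across two blocks the entry is constant and even or infinite: images in the same blocks satisfy
     the same relation, and erasing a side is harmless. *)
  have [n [n_even n_st]] := crossP _ _ (block s) (block t) Tst.
  have ev_k : ~~ odd k.
    move: n_even; rewrite -(n_st s t) // mst.
    by case=> [//|[j [[->]]]].
  case fs: (f s) => [s'|] /=; case ft: (f t) => [t'|] /=.
  + have /setIP[_ s'T] := fP _ _ fs; have /setIP[_ t'T] := fP _ _ ft.
    have mst' : m s' t' = Some k by rewrite n_st // -(n_st s t) // mst.
    have s't' : s' != t'.
      apply: contraNneq Tst => e; rewrite -(def_pblock tI (block s) s'T) e.
      by rewrite (def_pblock tI (block t) t'T).
    by rewrite -!altE; have := ae_rel [::] [::] s't' mst'; rewrite !cats0.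
  + by rewrite altw_nil //; apply: ae_refl.
  + by rewrite altw_nil //; apply: ae_refl.
  + exact: ae_refl.
- by move=> u v; rewrite /letter_map pmap_cat; apply: ae_refl.
- move=> w; exists (letter_map f w); split; last exact: ae_refl.
  elim: w => //= -[s b] w IH; rewrite /letter_map /=.
  case fs: (f s) => [s'|] //=; rewrite IH andbT.
  by have /setIP[] := fP _ _ fs.
- move=> w wX; suff -> : letter_map f w = w by apply: ae_refl.
  elim: w wX => //= -[s b] w IH /andP[/= sX wX].
  by rewrite /letter_map /= f_id //= [pmap _ _]IH.
Qed.

End Sufficiency.

Theorem theorem1p2 (S : finType) (m : S -> S -> option nat)
  (hM : coxeter_matrix m) :
  parabolic_retractable m <-> parabolic_retract_compatible m.
Proof.
split; [exact: retractable_compatible | exact: compatible_retractable].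
Qed.
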